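(* Let $\{F_n\}_{n\ge 0}$ be a sequence of natural numbers with $F_n\ge 1$ for $n\ge1$ (and $F_0=1$, or exceptionally $F_0=0$), and let $\Pi$ be the cobweb poset designated by it, with Möbius function $\mu$. Let $f:\Pi\to R$ be a function with values in an associative ring $R$ with identity, and suppose there is an element $p=\langle p_1,p_2\rangle\in\Pi$ such that $f(x)=0$ unless $x\ge p$. Suppose that for all $x\in\Pi$ $$g(x)=\sum_{y\in \Pi:\;y\le x}f(y).$$ Then for all $x\in\Pi$ $$f(x)=\sum_{y\in \Pi:\;y\le x}g(y)\,\mu(y,x).$$ Hence, in coordinates: if for all $\langle s,t\rangle\in\Pi$ $$g(\langle s,t\rangle)=\sum_{v=0}^{t-1}\sum_{u=1}^{F_v}f(\langle u,v\rangle)+f(\langle s,t\rangle),$$ then for all $\langle s,t\rangle\in\Pi$ $$f(\langle s,t\rangle)=\sum_{v\ge 0}\sum_{u=1}^{F_v}g(\langle u,v\rangle)\,\mu(\langle u,v\rangle,\langle s,t\rangle)$$ $$=\sum_{v\ge 0}\sum_{u=1}^{F_v}g(\langle u,v\rangle)\left[\delta(v,t)\delta(u,s)-\delta(v+1,t)+\sum_{k=2}^{\infty}\delta(v+k,t)(-1)^k\prod_{i=v+1}^{t-1}(F_i-1)\right].$$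
   Context: Cobweb poset: for $s\ge 1$ the $s$-th level is $\Phi_s=\{\langle j,s\rangle : 1\le j\le F_s\}$, and $\Phi_0=\{\langle 1,0\rangle\}$ is a single root (this is also the convention when $F_0=0$; in that case $\sum_{u=1}^{F_0}$ is read as the sum over the single element of $\Phi_0$, i.e. as if $F_0=1$). The cobweb poset is $\Pi=(V,\le)$ with $V=\bigcup_{s\ge 0}\Phi_s$ and $\langle s,t\rangle\le\langle u,v\rangle$ if and only if $t<v$, or $t=v$ and $s=u$. It is locally finite. Incidence algebra: for an associative ring $R$ with identity, $I(\Pi)$ is the set of functions $h:\Pi\times\Pi\to R$ with $h(x,y)=0$ unless $x\le y$, with pointwise addition and scalar multiplication and product $(h*k)(x,y)=\sum_{x\le z\le y}h(x,z)k(z,y)$. Its identity is the Kronecker delta $\delta(x,y)$. The zeta function is $\zeta(x,y)=1$ if $x\le y$ and $0$ otherwise, and the Möbius function $\mu$ is its inverse in $I(\Pi)$. On integers, $\delta(a,b)$ is the Kronecker delta. Integers are regarded as elements of $R$ in the usual way. In the coordinate formulas the sums over $v\ge0$ have only finitely many nonzero terms. *)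

(* Defs.v *)
From HB Require Import structures.
From mathcomp Require Import all_boot all_order all_algebra.
From mathcomp Require Import boolp classical_sets cardinality fsbigop.

Set Implicit Arguments.
Unset Strict Implicit.
Unset Printing Implicit Defensive.

Import Order.TTheory GRing.Theory.
Local Open Scope classical_set_scope.
Local Open Scope ring_scope.

(* Level 0 is always the single root, also when F 0 = 0. *)
Definition level (F : nat -> nat) (s : nat) : nat := if s is 0%N then 1%N else F s.

Definition cobweb (F : nat -> nat) : Type := {s : nat & 'I_(level F s)}.

HB.instance Definition _ (F : nat -> nat) := Choice.on (cobweb F).

(* The vertex <j, s> with 1 <= j <= level F s is [vertex i] with i : 'I_(level F s)
   and i = j - 1. *)
Definition vertex (F : nat -> nat) (s : nat) (i : 'I_(level F s)) : cobweb F :=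
  existT (fun s => 'I_(level F s)) s i.

Definition cobweb_le (F : nat -> nat) (x y : cobweb F) : bool :=
  (tag x < tag y)%N ||
  (tag x == tag y) && (nat_of_ord (tagged x) == nat_of_ord (tagged y)).

Lemma cobweb_le_eqVlt (F : nat -> nat) (x y : cobweb F) :
  cobweb_le x y = (x == y) || (tag x < tag y)%N.
Proof.
case: x y => s i [t j]; rewrite /cobweb_le /= orbC; congr (_ || _).
apply/andP/eqP => [[/eqP st]|[]].
  by case: _ / st j => j /eqP /val_inj ->.
by move=> st; case: _ / st j => j /eqP; rewrite eq_Tagged => /eqP /= ->.
Qed.

Lemma cobweb_le_refl (F : nat -> nat) : reflexive (@cobweb_le F).
Proof. by move=> x; rewrite cobweb_le_eqVlt eqxx. Qed.

Lemma cobweb_le_anti (F : nat -> nat) : antisymmetric (@cobweb_le F).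
Proof.
move=> x y; rewrite !cobweb_le_eqVlt => /andP[/orP[/eqP//|xy] /orP[/eqP//|yx]].
by move: (ltn_trans xy yx); rewrite ltnn.
Qed.

Lemma cobweb_le_trans (F : nat -> nat) : transitive (@cobweb_le F).
Proof.
move=> y x z; rewrite !cobweb_le_eqVlt => /orP[/eqP-> //|xy] /orP[/eqP<-|yz].
  by rewrite xy orbT.
by rewrite (ltn_trans xy yz) orbT.
Qed.

HB.instance Definition _ (F : nat -> nat) :=
  Order.Le_isPOrder.Build (Order.Disp tt tt) (cobweb F)
    (@cobweb_le_refl F) (@cobweb_le_anti F) (@cobweb_le_trans F).

(* Principal ideals are finite, so the finitely supported sums over them (and over
   the intervals) are the ordinary sums. *)
Lemma finite_cobweb_ideal (F : nat -> nat) (x : cobweb F) :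
  finite_set [set y : cobweb F | (y <= x)%O].
Proof.
pose g (p : {s : 'I_(tag x).+1 & 'I_(level F s)}) : cobweb F :=
  vertex (tagged p).
apply: (@sub_finite_set _ _ (g @` [set: _])); last exact/finite_image/finite_finset.
move=> [s i] /= le_sx.
have lt_s : (s < (tag x).+1)%N.
  by move: le_sx => /orP[/ltnW//|/andP[/= /eqP st _]]; rewrite st ltnS.
by exists (existT (fun s : 'I_(tag x).+1 => 'I_(level F s)) (Ordinal lt_s) i).
Qed.

Definition incidence_algebra (F : nat -> nat) (R : pzRingType) :
    set (cobweb F -> cobweb F -> R) :=
  [set h | forall x y, ~~ (x <= y)%O -> h x y = 0].

Definition incidence_mul (F : nat -> nat) (R : pzRingType)
    (h k : cobweb F -> cobweb F -> R) (x y : cobweb F) : R :=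
  \sum_(z \in [set z : cobweb F | (x <= z <= y)%O]) (h x z * k z y).

Definition incidence_one (F : nat -> nat) (R : pzRingType) (x y : cobweb F) : R :=
  (x == y)%:R.

Definition zeta (F : nat -> nat) (R : pzRingType) (x y : cobweb F) : R :=
  (x <= y)%O%:R.
Arguments zeta : clear implicits.

Definition is_incidence_inverse (F : nat -> nat) (R : pzRingType)
    (h k : cobweb F -> cobweb F -> R) : Prop :=
  [/\ incidence_algebra k,
      incidence_mul h k = @incidence_one F R &
      incidence_mul k h = @incidence_one F R].

(* The inverse of zeta in the incidence algebra; the default value 0 is not taken
   since zeta is invertible, and inverses are unique. *)
Definition mobius (F : nat -> nat) (R : pzRingType) : cobweb F -> cobweb F -> R :=
  xget (fun _ _ => 0) [set m | is_incidence_inverse (zeta F R) m].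
Arguments mobius : clear implicits.

Definition kdelta (R : pzRingType) (a b : nat) : R := (a == b)%:R.
Arguments kdelta : clear implicits.

(* Main.v *)
(** For v < t, the matrix inverse to zeta must satisfy
    c(v,t) = - (1 + sum_{v<w<t} F_w c(v,w)), because two vertices on different
    levels are always comparable; this recursion gives
    c(v,t) = (-1)^(t-v) prod_{v<i<t} (F_i - 1), whose value at t = v is 1.  Hence
    mu(x,y) = zeta(x,y) c(level x, level y), the factor zeta taking care of
    distinct vertices on the same level.  The inversion formula follows from
    zeta * mu = 1 by exchanging two finite sums over the principal ideal of x. *)
Require Import Defs.
From HB Require Import structures.
From mathcomp Require Import all_boot all_order all_algebra.
From mathcomp Require Import boolp classical_sets cardinality fsbigop.

Set Implicit Arguments.
Unset Strict Implicit.
Unset Printing Implicit Defensive.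

Import Order.TTheory GRing.Theory.
Local Open Scope classical_set_scope.
Local Open Scope ring_scope.

(** * Sums over principal ideals *)

Lemma cobweb_ltn_le F (x y : cobweb F) : (tag x < tag y)%N -> (x <= y)%O.
Proof. by move=> xy; apply/orP; left. Qed.

Lemma cobweb_le_tag F (x y : cobweb F) : (x <= y)%O -> (tag x <= tag y)%N.
Proof. by rewrite /Order.le /= cobweb_le_eqVlt => /predU1P[->|/ltnW]. Qed.

Lemma zeta_same_level F (R : pzRingType) t (i j : 'I_(level F t)) :
  zeta F R (vertex i) (vertex j) = (i == j)%:R.
Proof. by rewrite /zeta /Order.le /= /cobweb_le /= ltnn eqxx. Qed.

(** All vertices on levels below [t] lie under [vertex s], and on level [t] only [vertex s] itself
    does, so [vertex s :: below] lists the ideal without repetition. *)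
Lemma ideal_sum F (V : nmodType) (h : cobweb F -> V) t (s : 'I_(level F t)) :
  \sum_(y \in [set y : cobweb F | (y <= vertex s)%O]) h y =
  \sum_(0 <= v < t) \sum_(u < level F v) h (vertex u) + h (vertex s).
Proof.
pose below : seq (cobweb F) :=
  [seq vertex u | v <- index_iota 0 t, u <- enum 'I_(level F v)].
have belowP y : (y \in below) = (tag y < t)%N.
  apply/allpairsPdep/idP => [[v [u [+ _ ->]]]|yt]; first by rewrite mem_index_iota.
  by exists (tag y), (tagged y); rewrite mem_index_iota mem_enum; case: y yt.
have idealP y : (y \in vertex s :: below) = (y <= vertex s)%O.
  by rewrite inE belowP [RHS]cobweb_le_eqVlt.
rewrite (@fsbigE _ _ _ _ _ (vertex s :: below)).
- rewrite big_seq_cond (eq_bigl (mem (vertex s :: below))) => [|y]; last first.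
    by rewrite andb_idr // idealP => ys; apply/mem_set.
  rewrite -big_seq big_cons addrC big_allpairs_dep; congr (_ + _).
  by apply: eq_bigr => v _; rewrite big_enum.
- rewrite cons_uniq belowP ltnn allpairs_uniq_dep ?iota_uniq //.
    by move=> v _; apply: enum_uniq.
  by move=> [v i] [w j] _ _.
- by move=> y /=; rewrite idealP.
- by move=> y /= ys; rewrite idealP ys.
Qed.

(** Strong induction on the level: by [ideal_sum] the contributions of the lower levels agree and
    cancel, leaving the values at the top vertex. *)
Lemma ideal_sum_inj F (V : zmodType) (h k : cobweb F -> V) :
  (forall x, \sum_(y \in [set y : cobweb F | (y <= x)%O]) h y =
             \sum_(y \in [set y : cobweb F | (y <= x)%O]) k y) ->
  h =1 k.
Proof.
move=> hk [t s]; elim/ltn_ind: t s => t IHt s; move: (hk (vertex s)).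
rewrite !ideal_sum (eq_big_nat _ _ (F2 := fun v => \sum_u k (@vertex F v u))).
  exact: addrI.
by move=> v /andP[_ vt]; apply: eq_bigr => u _; apply: IHt.
Qed.

Lemma interval_sum F (V : nmodType) (h : cobweb F -> V) x y :
  (forall z, ~~ (x <= z)%O -> h z = 0) ->
  \sum_(z \in [set z : cobweb F | (x <= z <= y)%O]) h z =
  \sum_(z \in [set z : cobweb F | (z <= y)%O]) h z.
Proof.
move=> h0; apply: fsbig_widen => z /=; first by case/andP.
by case=> zy /negP; rewrite zy andbT => /h0.
Qed.

(** * Zeta summed level by level *)

Lemma zeta_level_sum F (R : pzRingType) (x : cobweb F) w :
  \sum_(u < level F w) zeta F R x (vertex u) =
  if (tag x < w)%N then (F w)%:R else (w == tag x)%:R.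
Proof.
case: ltngtP => [xw|wx|<-]; last first.
- case: x => t i /=; rewrite (bigD1 i) //= zeta_same_level eqxx big1 ?addr0 //.
  by move=> j; rewrite zeta_same_level eq_sym => /negPf->.
- rewrite big1 // => u _; rewrite /zeta (contraNF (@cobweb_le_tag F _ _)) //.
  by rewrite -ltnNge.
- rewrite (eq_bigr (fun=> 1)) => [|u _].
    (* Since [w] exceeds [tag x] it is positive, and there [level F w] computes to [F w]. *)
    by rewrite sumr_const card_ord; case: w xw.
  by rewrite /zeta cobweb_ltn_le.
Qed.

(** Levels below that of [x] contribute nothing, its own level contributes only through [x], and
    each higher level contributes with its full size. This turns convolution with zeta into a
    recursion on level numbers. *)
Lemma zeta_ideal_sum F (R : pzRingType) (x : cobweb F) t (k : nat -> R) :
  (tag x < t)%N ->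
  \sum_(0 <= w < t) (\sum_(u < level F w) zeta F R x (vertex u)) * k w =
  k (tag x) + \sum_((tag x).+1 <= w < t) (F w)%:R * k w.
Proof.
move=> xt; rewrite (big_cat_nat (leq0n _) (ltnW xt)) /= big_nat big1.
  rewrite add0r big_ltn // zeta_level_sum ltnn eqxx mul1r; congr (_ + _).
  by apply: eq_big_nat => w /andP[xw _]; rewrite zeta_level_sum xw.
move=> w /andP[_ wx]; rewrite zeta_level_sum ltnNge (ltnW wx) /=.
by rewrite (ltn_eqF wx) mul0r.
Qed.

Lemma zeta_ideal_sum0 F (R : pzRingType) (x : cobweb F) t (k : nat -> R) :
  (t <= tag x)%N ->
  \sum_(0 <= w < t) (\sum_(u < level F w) zeta F R x (vertex u)) * k w = 0.
Proof.
move=> tx; rewrite big_nat big1 // => w /andP[_ wt].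
have wx := leq_trans wt tx.
by rewrite zeta_level_sum ltnNge (ltnW wx) /= (ltn_eqF wx) mul0r.
Qed.

(** * The level coefficients c(v,t) and their two recursions *)

Definition mobius_coef (F : nat -> nat) (R : pzRingType) (v t : nat) : R :=
  (-1) ^+ (t - v) * \prod_(v.+1 <= i < t) ((F i)%:R - 1).

Lemma mobius_coef_refl F (R : pzRingType) v : mobius_coef F R v v = 1.
Proof. by rewrite /mobius_coef subnn big_geq // mulr1. Qed.

Lemma mobius_coefS F (R : pzRingType) v : mobius_coef F R v v.+1 = -1.
Proof. by rewrite /mobius_coef subSnn big_geq // mulr1. Qed.

Lemma mobius_coefSr F (R : pzRingType) v t :
  (v < t)%N -> mobius_coef F R v t.+1 = mobius_coef F R v t * (1 - (F t)%:R).
Proof.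
move=> vt; rewrite /mobius_coef big_nat_recr //= subSn ?(ltnW vt) // exprSr.
by rewrite -!mulrA mulN1r -mulrN opprB.
Qed.

Lemma mobius_coefSl F (R : pzRingType) v t :
  (v.+1 < t)%N -> mobius_coef F R v t = (1 - (F v.+1)%:R) * mobius_coef F R v.+1 t.
Proof.
move=> vt; rewrite /mobius_coef (big_ltn vt) -(@subnSK v) ?(ltnW vt) // exprSr.
rewrite -!mulrA mulN1r -mulNr opprB !mulrA; congr (_ * _).
(* [R] may be noncommutative, but a power of -1 commutes with every element. *)
by rewrite (commr_sign _ _).
Qed.

(** Passing from [t] to [t.+1] adds F_t c(v,t) to the sum and replaces c(v,t) by c(v,t) - c(v,t)
    F_t, so the total keeps its value 1 - 1 from t = v+1; the integer F_t commutes with c(v,t). *)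
Lemma mobius_coef_sumr F (R : pzRingType) v t : (v < t)%N ->
  1 + \sum_(v.+1 <= w < t) (F w)%:R * mobius_coef F R v w + mobius_coef F R v t = 0.
Proof.
elim: t => // t IHt; rewrite ltnS leq_eqVlt => /predU1P[->|vt].
  by rewrite big_geq // addr0 mobius_coefS subrr.
rewrite big_nat_recr //= mobius_coefSr // mulrBr mulr1 -[RHS](IHt vt).
by rewrite mulr_natr mulr_natl -!addrA; do 2!congr (_ + _); rewrite addrC subrK.
Qed.

(** Mirror image of [mobius_coef_sumr], with [t] fixed and induction on the gap: by [mobius_coefSl],
    c(v,t) and the first summand F_(v+1) c(v+1,t) merge into c(v+1,t). *)
Lemma mobius_coef_suml F (R : pzRingType) v t : (v < t)%N ->
  mobius_coef F R v t + \sum_(v.+1 <= w < t) (F w)%:R * mobius_coef F R w t + 1 = 0.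
Proof.
elim: {v}(t - v.+1)%N {-2}v (erefl (t - v.+1)%N) => [|n IHn] v.
  move/eqP; rewrite subn_eq0 => tv vt.
  have -> : t = v.+1 by apply/eqP; rewrite eqn_leq tv vt.
  by rewrite big_geq // addr0 mobius_coefS addNr.
move=> def_n vt; have vt1 : (v.+1 < t)%N by rewrite -subn_gt0 def_n.
rewrite big_ltn // mobius_coefSl // mulrBl mul1r addrA subrK.
by apply: IHn => //; rewrite subnS def_n.
Qed.


(** * The inverse of zeta *)

Lemma incidence_mul_idealE F (R : pzRingType) (h k : cobweb F -> cobweb F -> R) x y :
  incidence_algebra h ->
  incidence_mul h k x y =
  \sum_(z \in [set z : cobweb F | (z <= y)%O]) h x z * k z y.
Proof.
by move=> hI; apply: interval_sum => z xz; rewrite hI // mul0r.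
Qed.

Lemma zeta_incidence F (R : pzRingType) : incidence_algebra (zeta F R).
Proof. by move=> x y /negPf xy; rewrite /zeta xy. Qed.

Lemma zeta_le_level F (R : pzRingType) (x y : cobweb F) :
  (tag y <= tag x)%N -> zeta F R x y = (x == y)%:R.
Proof.
by move=> yx; rewrite /zeta /Order.le /= cobweb_le_eqVlt ltnNge yx orbF.
Qed.

(** The equation k * zeta = 1 prescribes the sums of each row [k x] over all principal ideals, and
    [ideal_sum_inj] recovers the row from them. This avoids proving associativity of the
    convolution. *)
Lemma incidence_inverse_unique F (R : pzRingType)
    (m m' : cobweb F -> cobweb F -> R) :
  is_incidence_inverse (zeta F R) m -> is_incidence_inverse (zeta F R) m' ->
  m = m'.
Proof.
have ideal_one k : is_incidence_inverse (zeta F R) k -> forall x y,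
    \sum_(z \in [set z : cobweb F | (z <= y)%O]) k x z = (x == y)%:R.
  move=> [kI _ kz] x y; rewrite -[RHS]/(incidence_one R x y) -kz.
  rewrite incidence_mul_idealE //; apply: eq_fsbigr => z /set_mem /= zy.
  by rewrite /zeta zy mulr1.
move=> mi mi'; apply/funext => x; apply/funext; apply: ideal_sum_inj => y.
by rewrite !ideal_one.
Qed.

(** Grouped by levels, zeta * mu reduces to [mobius_coef_suml] and mu * zeta to
    [mobius_coef_sumr]. *)
Lemma mobius_formula_inverse F (R : pzRingType) :
  is_incidence_inverse (zeta F R)
    (fun x y => zeta F R x y * mobius_coef F R (tag x) (tag y)).
Proof.
split=> [x y /zeta_incidence->||]; first by rewrite mul0r.
- apply/funext => x; apply/funext => -[t s].
  rewrite incidence_mul_idealE; last exact: zeta_incidence.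
  rewrite (ideal_sum _ s) -/(vertex s) /zeta lexx mul1r mobius_coef_refl mulr1.
  rewrite -/(zeta F R x (vertex s)).
  have -> : \sum_(0 <= v < t) \sum_(u < level F v) (x <= vertex u)%O%:R *
      ((vertex u <= vertex s)%O%:R * mobius_coef F R v t) =
      \sum_(0 <= v < t) (\sum_(u < level F v) zeta F R x (vertex u)) *
        mobius_coef F R v t.
    apply: eq_big_nat => v /andP[_ vt]; rewrite mulr_suml.
    by apply: eq_bigr => u _; rewrite (@cobweb_ltn_le F (vertex u)) // mul1r.
  (* If [t] does not exceed the level of [x], the lower levels contribute nothing and the term at
     [vertex s] is already the delta; otherwise the recursion yields 0. *)
  have [tx|xt] := leqP t (tag x).
    by rewrite zeta_ideal_sum0 // add0r zeta_le_level.
  rewrite zeta_ideal_sum // /zeta cobweb_ltn_le // mobius_coef_suml //.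
  by rewrite /incidence_one; case: eqP xt => // ->; rewrite ltnn.
- apply/funext => x; apply/funext => -[t s].
  rewrite incidence_mul_idealE => [|y z /zeta_incidence->]; last by rewrite mul0r.
  rewrite (ideal_sum _ s) -/(vertex s) {2 4}/zeta lexx mulr1.
  have -> : \sum_(0 <= v < t) \sum_(u < level F v)
      zeta F R x (vertex u) * mobius_coef F R (tag x) v *
        (vertex u <= vertex s)%O%:R =
      \sum_(0 <= v < t) (\sum_(u < level F v) zeta F R x (vertex u)) *
        mobius_coef F R (tag x) v.
    apply: eq_big_nat => v /andP[_ vt]; rewrite mulr_suml.
    by apply: eq_bigr => u _; rewrite (@cobweb_ltn_le F (vertex u)) // mulr1.
  have [tx|xt] := leqP t (tag x).
    rewrite zeta_ideal_sum0 // add0r zeta_le_level // /incidence_one.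
    (* When [x] is not [vertex s], the factor zeta is 0 and kills the coefficient, which for
       [t < tag x] is only the default value given by truncated subtraction. *)
    by case: eqP => [->|]; rewrite ?mobius_coef_refl ?mulr1 ?mul0r.
  rewrite zeta_ideal_sum // /zeta cobweb_ltn_le // mul1r mobius_coef_refl.
  rewrite mobius_coef_sumr //.
  by rewrite /incidence_one; case: eqP xt => // ->; rewrite ltnn.
Qed.

Lemma mobius_inverse F (R : pzRingType) :
  is_incidence_inverse (zeta F R) (mobius F R).
Proof.
apply: (@xgetPex _ _ [set m | is_incidence_inverse (zeta F R) m]).
by eexists; apply: mobius_formula_inverse.
Qed.

Lemma mobiusE F (R : pzRingType) (x y : cobweb F) :
  mobius F R x y = zeta F R x y * mobius_coef F R (tag x) (tag y).
Proof.
by rewrite (incidence_inverse_unique (mobius_inverse F R)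
                                     (mobius_formula_inverse F R)).
Qed.

(** * Moebius inversion *)

Lemma zeta_inversion F (R : pzRingType) m (f g : cobweb F -> R) :
  is_incidence_inverse (zeta F R) m ->
  (forall x, g x = \sum_(y \in [set y : cobweb F | (y <= x)%O]) f y) ->
  forall x, f x = \sum_(y \in [set y : cobweb F | (y <= x)%O]) g y * m y x.
Proof.
move=> [_ zm _] gE x; set I := [set y : cobweb F | (y <= x)%O].
have finI : finite_set I by apply: finite_cobweb_ideal.
(* In the expansion of [g y] the index [z] may run over all of [I] because [zeta F R z y] vanishes
   off the ideal of [y]; with both ranges fixed, the sums can be exchanged. *)
transitivity (\sum_(y \in I) \sum_(z \in I) f z * (zeta F R z y * m y x)).
  rewrite exchange_fsbig //.
  transitivity (\sum_(z \in I) f z * (z == x)%:R).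
    have Ix : I x by apply: lexx.
    rewrite (fsbigD1 x I _ finI Ix) /= eqxx mulr1 fsbig1 ?addr0 // => z [_ /eqP].
    by move/negPf->; rewrite mulr0.
  apply: eq_fsbigr => z _; rewrite -[(z == x)%:R]/(incidence_one R z x) -zm.
  rewrite incidence_mul_idealE; last exact: zeta_incidence.
  by rewrite (fsbig_distrr (times := *%R)).
apply: eq_fsbigr => y /set_mem yx.
have -> : g y = \sum_(z \in I) f z * zeta F R z y.
  rewrite gE -(@fsbig_widen _ _ _ _ [set z : cobweb F | (z <= y)%O] I).
  - by apply: eq_fsbigr => z /set_mem /= zy; rewrite /zeta zy mulr1.
  - by move=> z /= zy; apply: le_trans yx.
  - by move=> z [_ /= /negP/negPf zy]; rewrite /zeta zy mulr0.
rewrite !fsbig_finite // mulr_suml; apply: eq_bigr => z _; exact: mulrA.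
Qed.

(** * Coordinate formulas *)

Lemma fsum_kdelta (R : pzRingType) (v t : nat) (a : nat -> R) :
  \sum_(k \in [set k : nat | (2 <= k)%N]) (kdelta R (v + k)%N t * a k) =
  if (v + 2 <= t)%N then a (t - v)%N else 0.
Proof.
case: ifPn => vt; last first.
  apply: fsbig1 => k /= k2; rewrite /kdelta.
  case: eqP => [vk|_]; last by rewrite mul0r.
  by rewrite -vk leq_add2l k2 in vt.
(* Only k = t - v survives the delta, and the bound v + 2 <= t puts it in the range k >= 2. *)
rewrite -(@fsbig_widen _ _ _ _ [set (t - v)%N]).
- by rewrite fsbig_set1 /kdelta subnKC ?eqxx ?mul1r // (leq_trans _ vt) ?leq_addr.
- by move=> k /= ->; rewrite leq_subRL // (leq_trans _ vt) ?leq_addr.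
- move=> k [/= _ kt]; rewrite /kdelta; case: eqP => [vk|_]; last by rewrite mul0r.
  by case: kt; rewrite -vk addKn.
Qed.

(** The three summands live on the disjoint ranges t = v, t = v+1 and t >= v+2, and on each range
    the surviving one is zeta times c(v,t); for t < v everything vanishes. *)
Lemma mobius_coordinates F (R : pzRingType) v t
    (u : 'I_(level F v)) (s : 'I_(level F t)) :
  mobius F R (vertex u) (vertex s) =
  kdelta R v t * kdelta R u s - kdelta R (v + 1)%N t
  + \sum_(k \in [set k : nat | (2 <= k)%N])
      (kdelta R (v + k)%N t * (-1) ^+ k
       * \prod_((v + 1)%N <= i < t) ((F i)%:R - 1)).
Proof.
under eq_fsbigr do rewrite -mulrA.
rewrite fsum_kdelta mobiusE /= addn2 addn1 /kdelta.
have [vt|tv|vt] := ltngtP v t.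
- rewrite [zeta _ _ _ _]/zeta cobweb_ltn_le // mul1r mul0r add0r.
  have [vt1|tv1|<-] := ltngtP v.+1 t; first by rewrite oppr0 add0r.
    by rewrite ltnNge vt in tv1.
  by rewrite mobius_coefS addr0.
- have tv1 : (t < v.+1)%N by apply: leqW.
  rewrite zeta_le_level ?(ltnW tv) // (gtn_eqF tv1) subr0.
  rewrite ltnNge (ltnW tv1) mul0r !addr0.
  case: eqP => [/(congr1 tag) /= vt|_]; last by rewrite mul0r.
  by rewrite vt ltnn in tv.
- case: _ / vt s => s; rewrite zeta_same_level mobius_coef_refl mulr1 mul1r.
  by rewrite (gtn_eqF (ltnSn v)) subr0 ltnNge leqnSn addr0.
Qed.

(** Under the vanishing assumption, levels above [t] drop out and level [t] keeps only [s], which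
    leaves the shape of [ideal_sum]. *)
Lemma fsum_levels F (V : nmodType) (h : cobweb F -> V) t (s : 'I_(level F t)) :
  (forall y, ~~ (y <= vertex s)%O -> h y = 0) ->
  \sum_(v \in [set: nat]) \sum_(u < level F v) h (vertex u) =
  \sum_(y \in [set y : cobweb F | (y <= vertex s)%O]) h y.
Proof.
move=> h0; rewrite -(@fsbig_widen _ _ _ _ `I_t.+1) //; last first.
  move=> v [_ /= /negP]; rewrite -leqNgt => tv; apply: big1 => u _; apply: h0.
  by apply/negP => /cobweb_le_tag; rewrite leqNgt tv.
rewrite -fsbig_ord -(big_mkord xpredT (fun v => \sum_u h (@vertex F v u))).
rewrite big_nat_recr //= ideal_sum; congr (_ + _).
rewrite (bigD1 s) //= big1 ?addr0 // => u us; apply: h0.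
by rewrite /Order.le /= /cobweb_le /= ltnn eqxx.
Qed.

Theorem theorem1 (F : nat -> nat)
    (F_ge1 : forall n : nat, (1 <= n)%N -> (1 <= F n)%N)
    (F_0 : F 0%N = 1%N \/ F 0%N = 0%N)
    (R : pzRingType) (f g : cobweb F -> R)
    (f_supp : exists p : cobweb F, forall x : cobweb F, ~~ (p <= x)%O -> f x = 0) :
  ((forall x : cobweb F, g x = \sum_(y \in [set y : cobweb F | (y <= x)%O]) f y) ->
   forall x : cobweb F,
     f x = \sum_(y \in [set y : cobweb F | (y <= x)%O]) (g y * mobius F R y x))
  /\
  ((forall (t : nat) (s : 'I_(level F t)),
      g (vertex s) =
        \sum_(0 <= v < t) \sum_(u < level F v) f (vertex u) + f (vertex s)) ->
   forall (t : nat) (s : 'I_(level F t)),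
     f (vertex s) =
       \sum_(v \in [set: nat]) \sum_(u < level F v)
         (g (vertex u) * mobius F R (vertex u) (vertex s))
     /\
     \sum_(v \in [set: nat]) \sum_(u < level F v)
         (g (vertex u) * mobius F R (vertex u) (vertex s)) =
       \sum_(v \in [set: nat]) \sum_(u < level F v)
         (g (vertex u) *
          (kdelta R v t * kdelta R u s - kdelta R (v + 1)%N t
           + \sum_(k \in [set k : nat | (2 <= k)%N])
               (kdelta R (v + k)%N t * (-1) ^+ k
                * \prod_((v + 1)%N <= i < t) ((F i)%:R - 1))))).
Proof.
split=> [gE x|gE t s]; first exact: zeta_inversion (mobius_inverse F R) gE x.
split; last first.
  apply: eq_fsbigr => v _; apply: eq_bigr => u _.
  by rewrite mobius_coordinates.
rewrite (@fsum_levels F R (fun y => g y * mobius F R y (vertex s)) t s).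
  (* Read through [ideal_sum], the coordinate hypothesis on [g] is the hypothesis of the inversion
     formula. *)
  apply: zeta_inversion (mobius_inverse F R) _ _ => -[v u].
  by rewrite (ideal_sum f u) gE.
by move=> y; case: (mobius_inverse F R) => mI _ _ /mI->; rewrite mulr0.
Qed.
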